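(* Let $p$ be an autoregressive language model over a finite vocabulary $\mathcal{V}$ with horizon $T$, let $\bm{q}$ be a prompt, $\alpha>1$, $t\in\{0,\dots,T-1\}$, and let $\bm{x}_{0:t-1}$ be a partially generated sequence with $p(\bm{q},\bm{x}_{0:t-1})>0$. Let $\hat p^{(\mathrm{pow})}_{\alpha}(\cdot\mid\bm{q},\bm{x}_{0:t-1})$ be the Monte Carlo estimator of the power distribution built from $M_t$ sampled completions per token, $$\hat p^{(\mathrm{pow})}_\alpha(x_t\mid\bm{q},\bm{x}_{0:t-1})=\frac{p^\alpha(x_t\mid\bm{q},\bm{x}_{0:t-1})\,\hat\zeta_t(x_t)}{\sum_{x'_t\in\mathcal{V}}p^\alpha(x'_t\mid\bm{q},\bm{x}_{0:t-1})\,\hat\zeta_t(x'_t)},\qquad \hat\zeta_t(x'_t)=\frac{1}{M_t}\sum_{r=1}^{M_t}p^{\alpha-1}(\bm{x}^{[r]}_{t+1:T}\mid\bm{q},\bm{x}_{0:t-1},x'_t).$$ Then, for every token $x_t\in\mathcal{V}$, as $M_t\to\infty$, $$\mathbb{E}\big[\hat p^{(\mathrm{pow})}_{\alpha}(x_t\mid\bm{q},\bm{x}_{0:t-1})\big]=p^{(\mathrm{pow})}_{\alpha}(x_t\mid\bm{q},\bm{x}_{0:t-1})+\mathcal{O}\!\left(\frac{1}{M_t}\right),$$ where the expectation is with respect to the random completions used to estimate the scaling factors $\zeta_t(x'_t)$ for all tokens $x'_t\in\mathcal{V}$.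
   Context: $\mathcal{V}$ is a finite vocabulary and $T$ a fixed horizon; sequences are $\bm{x}_{0:T}\in\mathcal{V}^{T+1}$. An autoregressive language model $p$ assigns to the prompt $\bm{q}$ and every prefix $\bm{x}_{0:s-1}\in\mathcal{V}^{s}$, $0\le s\le T$, a probability distribution $p(\cdot\mid\bm{q},\bm{x}_{0:s-1})$ on $\mathcal{V}$. Block probabilities are given by the chain rule: $p(\bm{x}_{t+1:T}\mid\bm{q},\bm{x}_{0:t})=\prod_{s=t+1}^{T}p(x_s\mid\bm{q},\bm{x}_{0:s-1})$ and $p(\bm{q},\bm{x}_{0:t})=p(\bm{q})\prod_{s=0}^{t}p(x_s\mid\bm{q},\bm{x}_{0:s-1})$, with $p(\bm{q})>0$. Notation: $p^{\beta}(\cdot)=(p(\cdot))^{\beta}$; sums over $\bm{x}_{t+1:T}$ range over $\mathcal{V}^{T-t}$. The power distribution of the next token is $$p^{(\mathrm{pow})}_{\alpha}(x_t\mid\bm{q},\bm{x}_{0:t-1})=\frac{\sum_{\bm{x}_{t+1:T}}p^{\alpha}(\bm{q},\bm{x}_{0:t-1},x_t,\bm{x}_{t+1:T})}{\sum_{\bm{x}_{t:T}}p^{\alpha}(\bm{q},\bm{x}_{0:t-1},\bm{x}_{t:T})},$$ and the scaling factors are $\zeta_t(x'_t)=\sum_{\bm{x}_{t+1:T}}p^{\alpha}(\bm{x}_{t+1:T}\mid\bm{q},\bm{x}_{0:t-1},x'_t)$. Sampling: for each token $x'_t\in\mathcal{V}$, the completions $\bm{x}^{[1]}_{t+1:T},\dots,\bm{x}^{[M_t]}_{t+1:T}$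 appearing in $\hat\zeta_t(x'_t)$ are i.i.d. from $p(\cdot\mid\bm{q},\bm{x}_{0:t-1},x'_t)$ (they depend on $x'_t$, which is suppressed in the notation), and the completions for different tokens are independent. The constant in $\mathcal{O}(\cdot)$ may depend on everything ($p,\bm{q},\alpha,T,t,\mathcal{V}$, the prefix) except $M_t$. *)

(* Defs.v *)
From HB Require Import structures.
From mathcomp Require Export all_boot all_order all_algebra.
From mathcomp Require Export all_classical all_reals all_analysis.
Export Order.TTheory GRing.Theory Num.Theory.
Export numFieldNormedType.Exports.

Set Implicit Arguments.
Unset Strict Implicit.
Unset Printing Implicit Defensive.

Local Open Scope classical_set_scope.
Local Open Scope ring_scope.

(* Prefixes x_{0:s-1} are sequences of size s. The next-token weights are
   constrained only on the prefixes of size at most T, i.e. on those that occur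
   in sequences x_{0:T}. *)
Record language_model (R : realType) (V : finType) (Q : Type) (T : nat) :=
  LanguageModel {
    prompt_prob : Q -> R ;
    next_prob : Q -> seq V -> V -> R ;
    next_prob_ge0 : forall q (s : seq V) (x : V),
      (size s <= T)%N -> 0 <= next_prob q s x ;
    next_prob_sum1 : forall q (s : seq V),
      (size s <= T)%N -> \sum_(x : V) next_prob q s x = 1
  }.

Section PowerDistribution.
Context {R : realType} {V : finType} {Q : Type} {T : nat}.
Variables (p : language_model R V Q T) (q : Q).

(* p(c | q, s) by the chain rule, for a block c of tokens following s *)
Definition block_prob (s c : seq V) : R :=
  \prod_(i < size c) next_prob p q (s ++ take i c) (tnth (in_tuple c) i).

Definition joint_prob (s : seq V) : R := prompt_prob p q * block_prob [::] s.

Variables (alpha : R) (t : nat) (s : t.-tuple V).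

(* Here s = x_{0:t-1}, so for t <= T the blocks x_{t+1:T} and x_{t:T} have
   sizes T - t and (T - t).+1 respectively. *)
Definition power_dist (x : V) : R :=
  (\sum_(c : (T - t).-tuple V) joint_prob (s ++ x :: c) `^ alpha) /
  (\sum_(c : (T - t).+1.-tuple V) joint_prob (s ++ c) `^ alpha).

Definition zeta_hat (M : nat) (c : 'I_M -> (T - t).-tuple V) (x : V) : R :=
  M%:R^-1 * \sum_(r < M) block_prob (rcons s x) (c r) `^ (alpha - 1).

Definition power_dist_hat (M : nat) (c : V -> 'I_M -> (T - t).-tuple V)
    (x : V) : R :=
  (next_prob p q s x `^ alpha * zeta_hat (c x) x) /
  (\sum_(y : V) next_prob p q s y `^ alpha * zeta_hat (c y) y).

End PowerDistribution.

(* The value type S carries no sigma-algebra: every subset of S is an allowed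
   event. This is the intended notion when S is finite. *)
Definition mutually_independent {R : realType} (d : measure_display)
    (Omega : measurableType d) (P : probability Omega R) (I : finType)
    (S : Type) (X : I -> Omega -> S) : Prop :=
  forall (J : {set I}) (A : I -> set S),
    P (\bigcap_(i in [set` J]) X i @^-1` A i) =
    (\prod_(i in J) P (X i @^-1` A i))%E.

(* X x r is the r-th completion x_{t+1:T} sampled after s followed by x. *)
Definition sampled_completions {R : realType} {V : finType} {Q : Type}
    {T : nat} (p : language_model R V Q T) (q : Q) (t : nat) (s : t.-tuple V)
    (d : measure_display) (Omega : measurableType d) (P : probability Omega R)
    (M : nat) (X : V -> 'I_M -> Omega -> (T - t).-tuple V) : Prop :=
  [/\ forall x r (A : set ((T - t).-tuple V)), measurable (X x r @^-1` A),
      forall x r (c : (T - t).-tuple V),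
        P (X x r @^-1` [set c]) = (block_prob p q (rcons s x) c)%:E
    & mutually_independent P (fun i : V * 'I_M => X i.1 i.2)].

(* Main.v *)
(* The estimator is a ratio N / D with 0 <= N <= D, whose numerator and
   denominator are weighted sums of independent sample means, with expectations
   n and d > 0. Put c = n / d, U = N - c D and r = N / D - c, so that r D = U.
   From 1 = (D / d) (2 - D / d) + (1 - D / d)^2 one gets
     r = U / d + U (d - D) / d^2 + r (1 - D / d)^2.
   The first term has mean zero, and as |r| <= 1 the other two are bounded by
   squares of the deviations of N and D, hence have mean O(1 / M) because these
   are sums of uncorrelated terms. *)
Require Import Defs.
From mathcomp Require Import ring lra.

Set Implicit Arguments.
Unset Strict Implicit.
Unset Printing Implicit Defensive.

Local Open Scope classical_set_scope.
Local Open Scope ring_scope.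

(** * Bias of a ratio on a finite probability space *)

Lemma ratio_taylor_bound (R : realFieldType) (a b n d : R) :
  0 <= a <= b -> 0 <= n <= d -> 0 < d ->
  `|a / b - n / d - (a - n / d * b) / d| <=
    ((a - n) ^+ 2 + 3 * (b - d) ^+ 2) / d ^+ 2.
Proof.
move=> /andP[a0 ab] /andP[n0 nd] d0.
have dN0 : d != 0 by rewrite gt_eqF.
set c := n / d; set r := a / b - c.
have cd : c * d = n by rewrite divfK.
have c01 : 0 <= c <= 1 by rewrite divr_ge0 ?(ltW d0)//= ler_pdivrMr ?mul1r.
have ab01 : 0 <= a / b <= 1.
  have [b0|b0] := eqVneq b 0; first by rewrite b0 invr0 mulr0 lexx ler01.
  have bgt0 : 0 < b by rewrite lt_neqAle eq_sym b0 (le_trans a0).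
  by rewrite divr_ge0 ?(ltW bgt0)//= ler_pdivrMr ?mul1r.
(* This also holds when b = 0, since then a = 0; no lower bound on b is used. *)
have rb : r * b = a - c * b.
  have [b0|b0] := eqVneq b 0; last by rewrite /r mulrBl divfK.
  have -> : a = 0 by apply/eqP; rewrite eq_le a0 -b0 ab.
  by rewrite b0 !mulr0 subr0.
have [r1 r2] : -1 <= r /\ r <= 1 by rewrite /r; split; lra.
(* Both sides equal [r * (d - b) / d]; on the right every term is quadratic in the deviations
   [a - n] and [d - b]. *)
have -> : r - (a - c * b) / d =
    (((a - n) + c * (d - b)) * (d - b) + r * (d - b) ^+ 2) / d ^+ 2.
  have -> : (a - n) + c * (d - b) = r * b by rewrite rb -cd; ring.
  by rewrite -rb; field.
rewrite normrM (ger0_norm (_ : 0 <= (d ^+ 2)^-1)) ?invr_ge0 ?sqr_ge0//.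
rewrite ler_pM2r ?invr_gt0 ?exprn_gt0//.
have e2 : 0 <= (d - b) ^+ 2 by exact: sqr_ge0.
(* With A = a - n and E = d - b the numerator is A E + c E^2 + r E^2. By [p1] and [p2], |A E| <=
   (A^2 + E^2) / 2, and the other two terms are at most E^2 each in absolute value; the total A^2 /
   2 + 5 E^2 / 2 is rounded up to A^2 + 3 E^2. *)
have p1 := sqr_ge0 ((a - n) + (d - b)); have p2 := sqr_ge0 ((a - n) - (d - b)).
have /andP[c0 c1] := c01.
have q1 : 0 <= c * (d - b) ^+ 2 by exact: mulr_ge0.
have q2 : c * (d - b) ^+ 2 <= (d - b) ^+ 2 by rewrite ler_piMl.
have q3 : r * (d - b) ^+ 2 <= (d - b) ^+ 2 by rewrite ler_piMl.
have q4 : - (d - b) ^+ 2 <= r * (d - b) ^+ 2.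
  by rewrite -mulN1r ler_wpM2r.
have q5 := sqr_ge0 (a - n).
by rewrite ler_norml; apply/andP; split; nra.
Qed.

(** Since [n] and [d] are the means of [N] and [D], the linear term (N - n / d * D) / d averages to
    zero and can be subtracted without changing the bias. Averaging the pointwise bound then leaves
    the two variances. *)
Lemma ratio_bias (R : realFieldType) (K : finType) (mu N D : K -> R) (n d : R) :
  (forall k, 0 <= mu k) -> \sum_k mu k = 1 ->
  (forall k, 0 <= N k <= D k) -> 0 < d ->
  \sum_k N k * mu k = n -> \sum_k D k * mu k = d ->
  `|\sum_k N k / D k * mu k - n / d| <=
    (\sum_k (N k - n) ^+ 2 * mu k + 3 * \sum_k (D k - d) ^+ 2 * mu k) / d ^+ 2.
Proof.
move=> mu0 mu1 ND d0 En Ed.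
have n0d : 0 <= n <= d.
  rewrite -En -Ed sumr_ge0 /=; last first.
    by move=> k _; have /andP[? _] := ND k; exact: mulr_ge0.
  by apply: ler_sum => k _; have /andP[_ ?] := ND k; exact: ler_wpM2r.
have -> : \sum_k N k / D k * mu k - n / d =
    \sum_k (N k / D k - n / d - (N k - n / d * D k) / d) * mu k.
  transitivity (\sum_k N k / D k * mu k - n / d * \sum_k mu k -
      (\sum_k N k * mu k - n / d * \sum_k D k * mu k) / d).
    by rewrite mu1 mulr1 En Ed divfK ?gt_eqF// subrr mul0r subr0.
  rewrite mulr_sumr mulrBl -mulrA !mulr_sumr !mulr_suml -!sumrB.
  by apply: eq_bigr => k _; ring.
apply: le_trans (ler_norm_sum _ _ _) _.
rewrite mulr_sumr -big_split /= mulr_suml; apply: ler_sum => k _.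
rewrite normrM (ger0_norm (mu0 k)).
apply: le_trans (ler_wpM2r (mu0 k) (ratio_taylor_bound (ND k) n0d d0)) _.
by rewrite le_eqVlt; apply/orP; left; apply/eqP; ring.
Qed.

(** Off-diagonal products in the expanded square vanish, so the variance of a sum is the sum of the
    variances. *)
Lemma sum_sqr_uncorrelated (R : comPzRingType) (K I : finType) (mu : K -> R)
    (G : I -> K -> R) :
  (forall i j, i != j -> \sum_k G i k * G j k * mu k = 0) ->
  \sum_k (\sum_i G i k) ^+ 2 * mu k = \sum_i \sum_k G i k ^+ 2 * mu k.
Proof.
move=> G0.
transitivity (\sum_k \sum_i \sum_j G i k * G j k * mu k).
  apply: eq_bigr => k _; rewrite expr2 big_distrlr /= mulr_suml.
  by apply: eq_bigr => i _; rewrite mulr_suml.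
rewrite exchange_big /=; apply: eq_bigr => i _; rewrite exchange_big /=.
rewrite (bigD1 i) //= [X in _ + X]big1 ?addr0 => [|j ji].
  by apply: eq_bigr => k _; rewrite expr2.
by apply: G0; rewrite eq_sym.
Qed.

(** * Expectations as finite sums over a joint law *)

(** [g \o K] is a finite combination of indicators of the fibres of [K], so its integral can be
    taken term by term. *)
Lemma expectation_finite_range (R : realType) (d : measure_display)
    (Omega : measurableType d) (P : probability Omega R) (S : finType)
    (K : Omega -> S) (mK : forall k, measurable (K @^-1` [set k]))
    (g : S -> R) :
  'E_P[g \o K]%E = (\sum_k g k * fine (P (K @^-1` [set k])))%:E.
Proof.
have gKE w : ((g (K w))%:E = \sum_k (g k)%:E * (\1_(K @^-1` [set k]) w)%:E)%E.
  rewrite (bigD1 (K w)) //= big1 ?adde0 => [|k kK].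
    by rewrite indicE mem_set// mule1.
  rewrite indicE memNset ?mule0// => /= wk; by rewrite wk eqxx in kK.
rewrite unlock /=; under eq_integral do rewrite gKE.
rewrite integral_sum//= => [|k]; last exact/integrableZl/integrable_indic.
rewrite -sumEFin; apply: eq_bigr => k _.
rewrite integralZl//; last exact: integrable_indic.
by rewrite integral_indic// setIT EFinM fineK// fin_num_measure.
Qed.

Section JointLaw.
Context {R : realType} {d : measure_display} {Omega : measurableType d}
  (P : probability Omega R) {I S : finType} (X : I -> Omega -> S).
Hypothesis mX : forall i (A : set S), measurable (X i @^-1` A).

Definition joint_law (k : {ffun I -> S}) : R :=
  fine (P ((fun w => [ffun i => X i w]) @^-1` [set k])).

Lemma joint_law_ge0 k : 0 <= joint_law k.
Proof. exact: fine_ge0. Qed.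

Lemma expectation_joint_law (g : {ffun I -> S} -> R) :
  'E_P[fun w => g [ffun i => X i w]]%E = (\sum_k g k * joint_law k)%:E.
Proof.
apply: (@expectation_finite_range R d Omega P _ (fun w => [ffun i => X i w])).
move=> k; rewrite (_ : _ @^-1` _ = \bigcap_(i in setT) X i @^-1` [set k i]).
  by apply: fin_bigcap_measurable => // i _; exact: mX.
apply/seteqP; split=> w /= => [<- i _|wk]; first by rewrite ffunE.
by apply/ffunP => i; rewrite ffunE; exact: wk.
Qed.

Lemma sum_joint_law : \sum_k joint_law k = 1.
Proof.
have := expectation_joint_law (cst 1); rewrite expectation_cst => -[] ->.
by apply: eq_bigr => k _; rewrite mul1r.
Qed.

(** Both sides are the expectation of [h] at [X i], computed once through the whole family and once
    through [X i] alone. *)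
Lemma sum_joint_law_marginal (i : I) (h : S -> R) :
  \sum_(k : {ffun I -> S}) h (k i) * joint_law k =
  \sum_c h c * fine (P (X i @^-1` [set c])).
Proof.
have := expectation_joint_law (fun k => h (k i)).
under [X in expectation _ X]eq_fun do rewrite ffunE.
rewrite (@expectation_finite_range R d Omega P S (X i)) => [[<-]//|k].
exact: mX.
Qed.

(** The same double computation, now with the pair ([X i], [X j]), whose law is a product by
    independence. *)
Lemma sum_joint_law_indep (i j : I) (g h : S -> R) :
  mutually_independent P X -> i != j ->
  \sum_(k : {ffun I -> S}) g (k i) * h (k j) * joint_law k =
  (\sum_(k : {ffun I -> S}) g (k i) * joint_law k) *
  (\sum_(k : {ffun I -> S}) h (k j) * joint_law k).
Proof.
move=> indepX ij; rewrite !sum_joint_law_marginal.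
have preimE a b : (fun w => (X i w, X j w)) @^-1` [set (a, b)] =
    X i @^-1` [set a] `&` X j @^-1` [set b].
  by apply/seteqP; split=> w /= => [[-> ->]//|[-> ->]].
have := expectation_joint_law (fun k => g (k i) * h (k j)).
under [X in expectation _ X]eq_fun do rewrite !ffunE.
rewrite (@expectation_finite_range R d Omega P (S * S)%type
  (fun w => (X i w, X j w)) _ (fun c => g c.1 * h c.2)) => [[<-]|[a b]];
  last first.
  by rewrite preimE; apply: measurableI; exact: mX.
rewrite big_distrlr /= pair_big /=; apply: eq_bigr => -[a b] _ /=.
suff -> : P ((fun w => (X i w, X j w)) @^-1` [set (a, b)]) =
    (P (X i @^-1` [set a]) * P (X j @^-1` [set b]))%E.
  by rewrite fineM ?fin_num_measure//; ring.
(* Only the indices [i] and [j] are tested, so the value [[set b]] of the family away from [i]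
   matters at [j] alone. *)
have := indepX [set i; j]%SET (fun l => if l == i then [set a] else [set b]).
rewrite big_setU1 ?inE//= big_set1 eqxx eq_sym (negbTE ij) => <-.
rewrite preimE; congr (P _); apply/seteqP; split=> w /=.
  move=> [ia jb] l /=; rewrite !inE => /orP[] /eqP ->; first by rewrite eqxx.
  by rewrite eq_sym (negbTE ij).
move=> wij; split.
  by have := wij i; rewrite /= !inE !eqxx; apply.
by have := wij j; rewrite /= !inE eqxx orbT eq_sym (negbTE ij); apply.
Qed.

End JointLaw.

(** * Sample means: variance and bias of a weighted ratio *)

Section SampleMeans.
Context {R : realType} {V S : finType} {M : nat} {d : measure_display}
  {Omega : measurableType d} (P : probability Omega R).
Variables (X : V -> 'I_M -> Omega -> S) (pr Y : V -> S -> R).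
Hypothesis M_gt0 : (0 < M)%N.
Hypothesis mX : forall y r (A : set S), measurable (X y r @^-1` A).
Hypothesis lawX : forall y r c, P (X y r @^-1` [set c]) = (pr y c)%:E.
Hypothesis indepX :
  mutually_independent P (fun i : V * 'I_M => X i.1 i.2).
Hypothesis Y01 : forall y c, 0 <= Y y c <= 1.

Let zeta y := \sum_c Y y c * pr y c.
Let mu := joint_law P (fun i : V * 'I_M => X i.1 i.2).
(** A point [k] records one outcome of all samples for all tokens, so every sample mean is a
    function on the same finite space, weighted by [mu]. *)
Let Z (k : {ffun V * 'I_M -> S}) y := M%:R^-1 * \sum_(r < M) Y y (k (y, r)).

Let M_neq0 : M%:R != 0 :> R. Proof. by rewrite pnatr_eq0 -lt0n. Qed.

Let mu_ge0 k : 0 <= mu k. Proof. exact: joint_law_ge0. Qed.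

Let mX' (i : V * 'I_M) (A : set S) : measurable (X i.1 i.2 @^-1` A).
Proof. exact: mX. Qed.

Let sum_mu : \sum_k mu k = 1. Proof. exact: sum_joint_law. Qed.

Let sum_mu1 y r (h : S -> R) :
  \sum_(k : {ffun V * 'I_M -> S}) h (k (y, r)) * mu k = \sum_c h c * pr y c.
Proof.
rewrite (sum_joint_law_marginal P mX' (y, r)); apply: eq_bigr => c _.
by rewrite lawX.
Qed.

(** The weights [pr y] are known to form a probability only as the law of a sample. Sample number 0,
    which exists because [M] is positive, turns the mean into a sum against [mu]. *)
Lemma mean_in01 y : 0 <= zeta y <= 1.
Proof.
rewrite /zeta -(sum_mu1 y (Ordinal M_gt0)) sumr_ge0/= => [|k _]; last first.
  by rewrite mulr_ge0//; have /andP[] := Y01 y (k (y, Ordinal M_gt0)).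
rewrite -sum_mu; apply: ler_sum => k _; rewrite ler_piMl//.
by have /andP[] := Y01 y (k (y, Ordinal M_gt0)).
Qed.

Lemma sample_mean_unbiased y : \sum_k Z k y * mu k = zeta y.
Proof.
rewrite /Z; under eq_bigr do rewrite -mulrA mulr_suml.
rewrite -mulr_sumr exchange_big /=.
under eq_bigr do rewrite sum_mu1.
by rewrite sumr_const card_ord -[X in _ * X]mulr_natl mulKf.
Qed.

(** The deviation is a sum over pairs (y, r) of independent centred terms a_y / M * (Y - zeta_y),
    each of second moment at most (a_y / M)^2 because Y and zeta_y lie in [0, 1]. The M samples of a
    token together contribute a_y^2 / M. General weights [a] serve both the numerator and the
    denominator of the estimator. *)
Lemma sample_mean_variance (a : V -> R) :
  \sum_k (\sum_y a y * Z k y - \sum_y a y * zeta y) ^+ 2 * mu k <=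
    (\sum_y a y ^+ 2) * M%:R^-1.
Proof.
pose G (i : V * 'I_M) c := a i.1 / M%:R * (Y i.1 c - zeta i.1).
have GE k : \sum_y a y * Z k y - \sum_y a y * zeta y = \sum_i G i (k i).
  transitivity (\sum_y \sum_r G (y, r) (k (y, r))); last first.
    by rewrite pair_bigA /=; apply: eq_bigr => -[].
  rewrite -sumrB; apply: eq_bigr => y _; rewrite /G /= -mulr_sumr.
  rewrite sumrB sumr_const card_ord.
  by rewrite /Z -[zeta y *+ M]mulr_natl; field.
have G0 i : \sum_(k : {ffun V * 'I_M -> S}) G i (k i) * mu k = 0.
  case: i => y r; rewrite /G /=; under eq_bigr do rewrite -mulrA mulrBl.
  rewrite -mulr_sumr sumrB sum_mu1 -mulr_sumr sum_mu mulr1.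
  by rewrite subrr mulr0.
under eq_bigr do rewrite GE.
rewrite (sum_sqr_uncorrelated
  (G := fun i (k : {ffun V * 'I_M -> S}) => G i (k i))) => [|i j ij];
  last first.
  by rewrite sum_joint_law_indep// G0 mul0r.
apply: (@le_trans _ _ (\sum_(i : V * 'I_M) (a i.1 / M%:R) ^+ 2)).
  apply: ler_sum => i _.
  rewrite -[leRHS]mulr1 -[X in _ <= _ * X]sum_mu mulr_sumr.
  apply: ler_sum => k _; apply: ler_wpM2r => //.
  rewrite /G exprMn ler_piMr ?sqr_ge0//.
  have /andP[? ?] := Y01 i.1 (k i); have /andP[? ?] := mean_in01 i.1.
  by rewrite expr2; nra.
rewrite -(pair_bigA _ (fun y r => (a y / M%:R) ^+ 2)) /= mulr_suml.
apply: ler_sum => y _; rewrite sumr_const card_ord -mulr_natl.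
by rewrite le_eqVlt; apply/orP; left; apply/eqP; field.
Qed.

(** The numerator is one of the nonnegative summands of the denominator, so [ratio_bias] applies
    over [mu]; both variances are O(1 / M). *)
Lemma sample_ratio_bias (w : V -> R) (x : V) :
  (forall y, 0 <= w y) -> 0 < \sum_y w y * zeta y ->
  `|fine 'E_P[fun o => (w x * (M%:R^-1 * \sum_(r < M) Y x (X x r o)) /
       \sum_y w y * (M%:R^-1 * \sum_(r < M) Y y (X y r o)))%R]%E -
    w x * zeta x / \sum_y w y * zeta y| <=
  (w x ^+ 2 + 3 * \sum_y w y ^+ 2) / (\sum_y w y * zeta y) ^+ 2 * M%:R^-1.
Proof.
move=> w0 D_gt0; set D := \sum_y w y * zeta y in D_gt0 *.
have Z0 k y : 0 <= Z k y.
  rewrite mulr_ge0 ?invr_ge0 ?ler0n// sumr_ge0// => r _.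
  by have /andP[] := Y01 y (k (y, r)).
have := expectation_joint_law P mX'
  (fun k => w x * Z k x / \sum_y w y * Z k y).
under [X in expectation _ X]eq_fun => o.
  rewrite /Z; under eq_bigr do rewrite ffunE /=.
  under [in X in _ / X]eq_bigr do under eq_bigr do rewrite ffunE /=.
  over.
move=> -> /=.
apply: le_trans (ratio_bias (d := D) mu_ge0 sum_mu _ D_gt0 _ _) _.
- move=> k; rewrite mulr_ge0//= (bigD1 x)//= lerDl sumr_ge0// => y _.
  exact: mulr_ge0.
- rewrite -(sample_mean_unbiased x) mulr_sumr; apply: eq_bigr => k _.
  exact/esym/mulrA.
- rewrite /D; transitivity (\sum_y \sum_k w y * Z k y * mu k).
    by rewrite exchange_big /=; apply: eq_bigr => k _; rewrite mulr_suml.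
  apply: eq_bigr => y _; rewrite -sample_mean_unbiased mulr_sumr.
  by apply: eq_bigr => k _; exact/esym/mulrA.
rewrite [leRHS]mulrAC; apply: ler_wpM2r; first by rewrite invr_ge0 sqr_ge0.
rewrite [leRHS]mulrDl -[X in _ <= _ + X]mulrA; apply: lerD; last first.
  by apply: ler_wpM2l => //; exact: sample_mean_variance.
(* The numerator is the weighted sum whose weights are concentrated at [x]. *)
pose a y := if y == x then w x else 0.
have aE (F : V -> R) : \sum_y a y * F y = w x * F x.
  rewrite (bigD1 x)//= /a eqxx big1 ?addr0// => y /negbTE ->.
  by rewrite mul0r.
have := sample_mean_variance a.
under [X in X <= _ -> _]eq_bigr do rewrite !aE.
by under [X in _ <= X * _ -> _]eq_bigr do rewrite expr2; rewrite aE /a eqxx.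
Qed.

End SampleMeans.

(** * Chain rule and the power distribution *)

Lemma big_tuple_cons (R : nmodType) (V : finType) (n : nat)
    (F : seq V -> R) :
  \sum_(c : n.+1.-tuple V) F c = \sum_(y : V) \sum_(c : n.-tuple V) F (y :: c).
Proof.
rewrite pair_big /=.
rewrite (reindex (fun yc : V * n.-tuple V => [tuple of yc.1 :: yc.2])) //=.
exists (fun c => (thead c, [tuple of behead c])) => [[y c] _|c _] /=.
  by congr pair; apply: val_inj.
by rewrite -tuple_eta.
Qed.

Section PowerDistribution.
Context {R : realType} {V : finType} {Q : Type} {T : nat}.
Variables (p : language_model R V Q T) (q : Q).

Lemma block_prob_cat (s c1 c2 : seq V) :
  block_prob p q s (c1 ++ c2) =
  block_prob p q s c1 * block_prob p q (s ++ c1) c2.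
Proof.
(* [tnth] is traded for [nth] to split the product at [size c1]. This takes a default token; when
   [V] is empty, [c1] is the empty block. *)
have blockE x0 s0 (c : seq V) : block_prob p q s0 c =
    \prod_(i < size c) next_prob p q (s0 ++ take i c) (nth x0 c i).
  by apply: eq_bigr => i _; rewrite (tnth_nth x0).
have [x0 _|V0] := pickP V; last first.
  by case: c1 => [|y]; [rewrite /block_prob big_ord0 mul1r cats0|have := V0 y].
rewrite !(blockE x0) size_cat big_split_ord /=.
  congr (_ * _).
  by apply: eq_bigr => i _; rewrite nth_cat ltn_ord take_cat ltn_ord.
apply: eq_bigr => i _; rewrite nth_cat take_cat ltnNge leq_addr /= addKn.
by rewrite catA.
Qed.

Lemma block_prob_cons (s c : seq V) (x : V) :
  block_prob p q s (x :: c) = next_prob p q s x * block_prob p q (rcons s x) c.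
Proof.
rewrite -cat1s block_prob_cat cats1; congr (_ * _).
by rewrite /block_prob big_ord_recl big_ord0 mulr1 /= cats0 (tnth_nth x).
Qed.

(** The bound is [T.+1] because the last token of the block is conditioned on a prefix one shorter
    than the whole, hence of size at most [T]. *)
Lemma block_prob_ge0 (s c : seq V) :
  (size s + size c <= T.+1)%N -> 0 <= block_prob p q s c.
Proof.
elim: c s => [|x c IHc] s /= sT; first by rewrite /block_prob big_ord0.
rewrite block_prob_cons mulr_ge0 ?IHc ?size_rcons ?addSnnS// next_prob_ge0//.
by rewrite -ltnS (leq_trans _ sT)// addnS ltnS leq_addr.
Qed.

Lemma sum_block_prob (s : seq V) (n : nat) :
  (size s + n <= T.+1)%N -> \sum_(c : n.-tuple V) block_prob p q s c = 1.
Proof.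
elim: n s => [|n IHn] s sT.
  rewrite (big_pred1 [tuple]) => [|c]; first by rewrite /block_prob big_ord0.
  by apply/esym/eqP; exact: tuple0.
rewrite (big_tuple_cons _ (block_prob p q s)).
under eq_bigr => y _.
  under eq_bigr do rewrite block_prob_cons.
  rewrite -mulr_sumr IHn ?size_rcons ?addSnnS// mulr1; over.
by apply: next_prob_sum1; rewrite -ltnS (leq_trans _ sT)// addnS ltnS leq_addr.
Qed.

(* The factor p(q, s)^alpha cancels between numerator and denominator. *)
Lemma power_distE (alpha : R) (t : nat) (s : t.-tuple V) (x : V) :
  0 < joint_prob p q s -> (t <= T)%N ->
  power_dist p q alpha s x =
  (next_prob p q s x `^ alpha *
     \sum_(c : (T - t).-tuple V) block_prob p q (rcons s x) c `^ alpha) /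
  (\sum_y next_prob p q s y `^ alpha *
     \sum_(c : (T - t).-tuple V) block_prob p q (rcons s y) c `^ alpha).
Proof.
move=> s0 tT.
have jointE y (c : (T - t).-tuple V) : joint_prob p q (s ++ y :: c) `^ alpha =
    joint_prob p q s `^ alpha *
    (next_prob p q s y `^ alpha * block_prob p q (rcons s y) c `^ alpha).
  have n0 : 0 <= next_prob p q s y by rewrite next_prob_ge0 ?size_tuple.
  have b0 : 0 <= block_prob p q (rcons s y) c.
    by rewrite block_prob_ge0// size_rcons !size_tuple addSn subnKC.
  rewrite {1}/joint_prob block_prob_cat mulrA -/(joint_prob p q s) cat0s.
  rewrite block_prob_cons (powRM _ (ltW s0)) ?mulr_ge0//.
  by rewrite (powRM _ n0 b0).
have sumE y : \sum_(c : (T - t).-tuple V) joint_prob p q (s ++ y :: c) `^ alpha =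
    joint_prob p q s `^ alpha * (next_prob p q s y `^ alpha *
     \sum_(c : (T - t).-tuple V) block_prob p q (rcons s y) c `^ alpha).
  by under eq_bigr do rewrite jointE; rewrite -!mulr_sumr.
rewrite /power_dist sumE.
have -> : \sum_(c : (T - t).+1.-tuple V) joint_prob p q (s ++ c) `^ alpha =
    \sum_(y : V) \sum_(c : (T - t).-tuple V)
      joint_prob p q (s ++ y :: c) `^ alpha.
  exact: (big_tuple_cons _ (fun c => joint_prob p q (s ++ c) `^ alpha)).
under [in X in _ / X]eq_bigr do rewrite sumE.
by rewrite -mulr_sumr -mulf_div divff ?mul1r// gt_eqF// powR_gt0.
Qed.

End PowerDistribution.

Lemma block_prob_le1 (R : realType) (V : finType) (Q : Type) (T : nat)
    (p : language_model R V Q T) (q : Q) (s : seq V) (n : nat)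
    (c : n.-tuple V) :
  (size s + n <= T.+1)%N -> block_prob p q s c <= 1.
Proof.
move=> sT; rewrite -(sum_block_prob p q sT) (bigD1 c)//= lerDl.
rewrite sumr_ge0// => c' _.
by rewrite block_prob_ge0// size_tuple.
Qed.

(** Probabilities summing to 1 cannot all vanish: some token, and then some completion of it, has
    positive probability, and its term is positive among nonnegative ones. *)
Lemma power_normalizer_gt0 (R : realType) (V : finType) (Q : Type) (T : nat)
    (p : language_model R V Q T) (q : Q) (alpha : R) (s : seq V) (n : nat) :
  (size s + n <= T)%N ->
  0 < \sum_y next_prob p q s y `^ alpha *
        \sum_(c : n.-tuple V) block_prob p q (rcons s y) c `^ alpha.
Proof.
move=> sT.
have posP (I : finType) (F : I -> R) (i : I) :
    (forall j, 0 <= F j) -> 0 < F i -> 0 < \sum_j F j.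
  by move=> F0 Fi; rewrite (bigD1 i)//= ltr_pwDl// sumr_ge0.
have sizeT : (size s <= T)%N by rewrite (leq_trans _ sT)// leq_addr.
have rcT y : (size (rcons s y) + n <= T.+1)%N by rewrite size_rcons addSn ltnS.
have [y /= y_gt0] : exists y, 0 < next_prob p q s y.
  have n0 (y : V) : true -> 0 <= next_prob p q s y by rewrite next_prob_ge0.
  have [|y /andP[_ y_gt0]] := psumr_neq0P n0; last by exists y.
  by rewrite next_prob_sum1//; apply/eqP; exact: oner_neq0.
have [c c_gt0] : exists c : n.-tuple V, 0 < block_prob p q (rcons s y) c.
  have b0 (c : n.-tuple V) : true -> 0 <= block_prob p q (rcons s y) c.
    by rewrite block_prob_ge0// size_tuple.
  have [|c /andP[_ c_gt0]] := psumr_neq0P b0; last by exists c.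
  by rewrite sum_block_prob//; apply/eqP; exact: oner_neq0.
apply: (posP _ _ y) => [z|].
  by rewrite mulr_ge0 ?powR_ge0// sumr_ge0// => *; exact: powR_ge0.
rewrite mulr_gt0 ?powR_gt0//; apply: (posP _ _ c) => [*|]; first exact: powR_ge0.
exact: powR_gt0.
Qed.

(** * The bias of the Monte Carlo estimator *)

Theorem lemma3p2 (R : realType) (V : finType) (Q : Type) (T : nat)
    (p : language_model R V Q T) (q : Q) (alpha : R) (t : nat)
    (s : t.-tuple V)
    (hq : 0 < prompt_prob p q)
    (halpha : 1 < alpha)
    (ht : (t < T)%N)
    (hs : 0 < joint_prob p q s)
    (d : nat -> measure_display)
    (Omega : forall M : nat, measurableType (d M))
    (P : forall M : nat, probability (Omega M) R)
    (X : forall M : nat, V -> 'I_M -> Omega M -> (T - t).-tuple V)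
    (hX : forall M : nat, sampled_completions p q s (P M) (@X M))
    (x : V) :
  (fun M : nat =>
     fine 'E_(P M)[fun w => power_dist_hat p q alpha s
                              (fun y r => X M y r w) x]%E) =
  cst (power_dist p q alpha s x) +O_\oo (fun M : nat => M%:R^-1 : R).
Proof.
have tT := ltnW ht.
have rcT y : (size (rcons s y) + (T - t) <= T.+1)%N.
  by rewrite size_rcons size_tuple addSn subnKC.
have b0 y (c : (T - t).-tuple V) : 0 <= block_prob p q (rcons s y) c.
  by rewrite block_prob_ge0// size_tuple.
pose Y y (c : (T - t).-tuple V) := block_prob p q (rcons s y) c `^ (alpha - 1).
have Y01 y c : 0 <= Y y c <= 1.
  have a0 : 0 <= alpha - 1 by rewrite subr_ge0 ltW.
  have := @ge0_ler_powR R _ a0 (block_prob p q (rcons s y) c) 1.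
  rewrite powR1 /Y powR_ge0 !nnegrE; apply => //; exact: block_prob_le1.
(* p^alpha = p^(alpha - 1) * p, also where p = 0 since alpha > 0; thus the scaling factor is the
   mean of [Y y] under the law of the completions. *)
have zetaE y : \sum_(c : (T - t).-tuple V) block_prob p q (rcons s y) c `^ alpha =
    \sum_(c : (T - t).-tuple V) Y y c * block_prob p q (rcons s y) c.
  apply: eq_bigr => c _; rewrite mulrC /Y mulr_powRB1//.
  by rewrite (lt_trans _ halpha).
have D_gt0 := @power_normalizer_gt0 R V Q T p q alpha s (T - t).
rewrite size_tuple subnKC// in D_gt0; have {D_gt0} := D_gt0 (leqnn T).
under eq_bigr do rewrite zetaE; move=> D_gt0.
apply/eqaddOP; near=> k; near=> M.
have M_gt0 : (0 < M)%N by near: M; exact: nbhs_infty_gt.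
have [mX lawX indepX] := hX M.
rewrite [leLHS](_ : _ = `|fine 'E_(P M)[fun o => power_dist_hat p q alpha s
   (fun y r => @X M y r o) x]%E - power_dist p q alpha s x|)//.
rewrite power_distE// zetaE; under [in X in _ / X]eq_bigr do rewrite zetaE.
apply: le_trans (sample_ratio_bias M_gt0 mX lawX indepX Y01 x _ D_gt0) _.
  by move=> y; exact: powR_ge0.
rewrite [X in _ <= _ * X]ger0_norm ?invr_ge0 ?ler0n//.
apply: ler_wpM2r; first by rewrite invr_ge0.
(* [k] only has to exceed the constant of [sample_ratio_bias], which depends on the weights and
   scaling factors but not on [M] or the probability space. *)
by near: k; apply: nbhs_pinfty_ge; exact: num_real.
Unshelve. all: by end_near.
Qed.
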